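(* Let $[\mathcal D_x]$ be the optimally accurate discrete differential operator with central stencil $L=R\ge1$. There exists a constant $C$ determined by the operator $[\mathcal D_x]$ (in particular, independent of $h=1/N$) such that for every $N$, every solution of the semi-discretized central HV scheme on the uniform grid with $N$ cells, and all $t\ge0$, $$\sum_{j=0}^{N-1}\left[\overline u_{j+1/2}(t)\right]^2+\sum_{j=0}^{N-1}\left[u_j(t)\right]^2\le C\left(\sum_{j=0}^{N-1}\left[\overline u_{j+1/2}(0)\right]^2+\sum_{j=0}^{N-1}\left[u_j(0)\right]^2\right).$$
   Context: Setting: the advection equation $u_t+u_x=0$ on $[0,1]$ with periodic boundary conditions, on the uniform grid $x_j=jh$, $h=1/N$. The hybrid-variable (HV) method evolves approximations $u_j(t)$ of the nodal values $u(x_j,t)$ and $\overline u_{j+1/2}(t)$ of the cell averages $\frac1h\int_{x_j}^{x_{j+1}}u(x,t)\,dx$ (all indices $N$-periodic; real-valued unknowns). Central stencil: $L=R\ge1$, $l'=r'=\lfloor R/2\rfloor$, $l=r=R-r'$. The discrete differential operator is $$[\mathcal D_xu]_j=\frac1h\sum_{k=-r}^{r-1}\alpha_k\overline u_{j+k+1/2}+\frac1h\sum_{k=-r'}^{r'}\beta_ku_{j+k},$$ where the real constants $\alpha_k,\beta_k$ (independent of $h$ and $j$) are the unique ones giving the optimal order of accuracy $p=L+R$. Here order $p$ means that, applied to the exact cell averages and nodal values of any sufficiently smooth $u(x)$, $[\mathcal D_xu]_j=u_x(x_j)+c_pu^{(p+1)}(x_j)h^p+O(h^{p+1})$ with $c_p\ne0$.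 Explicitly, with $C^{m,n}_k=\frac{m!\,n!}{(m+k)!\,(n-k)!}$, $H_k=1+\frac12+\cdots+\frac1k$, $H_0=0$, and $\zeta^{m,n}_k=H_{m+k}-H_{n-k}$: $\beta_0=0$ and $\beta_\nu=-\frac2\nu C^{r,r}_\nu C^{r',r'}_\nu$ for $0<|\nu|\le r'$; $\alpha_\nu=\sum_{k=\nu+1}^rt_k$ for $0\le\nu\le r-1$ and $\alpha_\nu=-\alpha_{-1-\nu}$ for $-r\le\nu<0$; where, if $r'=r$, $t_k=\frac{2(1+2k\zeta^{r,r}_k)}{k^2}[C^{r,r}_k]^2$ for $1\le k\le r$, and, if $r'=r-1$, $t_k=\frac{2(1+k(\zeta^{r,r}_k+\zeta^{r',r'}_k))}{k^2}C^{r,r}_kC^{r',r'}_k$ for $1\le k\le r-1$ and $t_r=\frac2{r^2}C^{r,r}_rC^{r-1,r}_r$. Semi-discretized central HV scheme: the linear ODE system, for all $j$, $$\overline u_{j+1/2}'+\frac1h(u_{j+1}-u_j)=0,\qquad u_j'+[\mathcal D_xu]_j=0.$$ *)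

(* Defs.v *)
From HB Require Import structures.
From mathcomp Require Import all_boot all_order all_algebra.
From mathcomp Require Import all_classical all_reals all_analysis.

Set Implicit Arguments.
Unset Strict Implicit.
Unset Printing Implicit Defensive.

Import Order.TTheory GRing.Theory Num.Theory.
Import numFieldNormedType.Exports.

Local Open Scope ring_scope.
Local Open Scope classical_set_scope.

(* Grid functions are indexed by [int]; [ubar j] stands for the cell average
   $\overline u_{j+1/2}$ over the cell $[x_j, x_{j+1}]$. *)

(* Central stencil $L = R = m$: $l' = r' = \lfloor m/2 \rfloor$ (nodal values)
   and $l = r = m - r'$ (cell averages). *)
Definition node_radius (m : nat) : nat := m./2.

Definition cell_radius (m : nat) : nat := (m - node_radius m)%N.

(* The offset is [i%:Z - r], so the sums run over $-r \le k \le r-1$ and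
   $-r' \le k \le r'$.  The values of [alpha] and [beta] outside of these ranges
   are irrelevant. *)
Definition hv_Dx (R : realType) (m : nat) (alpha beta : int -> R) (h : R)
    (ubar u : int -> R) (j : int) : R :=
  h^-1 * (\sum_(i < (cell_radius m).*2)
            let k := i%:Z - (cell_radius m)%:Z in alpha k * ubar (j + k))
  + h^-1 * (\sum_(i < (node_radius m).*2.+1)
            let k := i%:Z - (node_radius m)%:Z in beta k * u (j + k)).

Definition cell_average (R : realType) (u : R -> R) (a h : R) : R :=
  h^-1 * (\int[@lebesgue_measure R]_(y in `[a, a + h]) u y).

Definition continuously_differentiable (R : realType) (n : nat) (u : R -> R)
    : Prop :=
  (forall k : nat, (k < n)%N -> forall x : R, derivable (u^`(k)) x 1) /\
  continuous (u^`(n)).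

(* The point $x$ plays the role of $x_j$ and is kept fixed while $h \to 0^+$;
   the grid points are $x + k h$.  The differentiability class $C^{p+2}$ is
   the one in which the Taylor expansion has a remainder $O(h^{p+1})$. *)
Definition has_order (R : realType) (m : nat) (alpha beta : int -> R)
    (p : nat) : Prop :=
  exists c : R, c != 0 /\
  forall u : R -> R, continuously_differentiable p.+2 u ->
  forall x : R,
    (fun h : R =>
       hv_Dx m alpha beta h
         (fun k : int => cell_average u (x + k%:~R * h) h)
         (fun k : int => u (x + k%:~R * h)) 0
       - (u^`()%classic x + c * u^`(p.+1)%classic x * h ^+ p))
    =O_ (0^'+) (fun h : R => h ^+ p.+1).

(* Solutions on $[0, +\infty)$: the equations hold for $t > 0$, and the unknowns
   are continuous up to the initial time (one-sided at $0$). *)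
Definition hv_solution (R : realType) (m : nat) (alpha beta : int -> R)
    (N : nat) (ubar u : int -> R -> R) : Prop :=
  let h : R := N%:R^-1 in
  [/\ forall t : R, 0 <= t ->
        periodic (ubar^~ t) N%:Z /\ periodic (u^~ t) N%:Z,
      forall j : int, {within `[0, +oo[, continuous (ubar j)} /\
                      {within `[0, +oo[, continuous (u j)},
      forall (j : int) (t : R), 0 < t ->
        derivable (ubar j) t 1 /\
        (ubar j)^`()%classic t + h^-1 * (u (j + 1) t - u j t) = 0
    & forall (j : int) (t : R), 0 < t ->
        derivable (u j) t 1 /\
        (u j)^`()%classic t
        + hv_Dx m alpha beta h (fun k => ubar k t) (fun k => u k t) j = 0].

(* Main.v *)
Require Import Defs.
From mathcomp Require Import all_boot all_order all_algebra.
From mathcomp Require Import all_classical all_reals all_analysis.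
From mathcomp Require Import zify ring lra.

Set Implicit Arguments.
Unset Strict Implicit.
Unset Printing Implicit Defensive.

Import Order.TTheory GRing.Theory Num.Theory.
Import numFieldNormedType.Exports.

Local Open Scope ring_scope.

(** The scheme conserves a quadratic energy that is equivalent to the l2 norm,
uniformly in the number of cells.  Let r and s be the radii of the stencils for
averages and for nodal values, so that r + s = m.  Put
t_k = alpha_(k-1) - alpha_k for 1 <= k <= r, with alpha_r = 0.  The energy is
  sum_j u_j^2 + sum_(1 <= k <= r) t_k sum_j (ubar_j + ... + ubar_(j+k-1))^2.
In Fourier variables, after shifting the averages to the cell centers, the
system has the matrix -i [[0, 2 sin(x/2)], [a(x), b(x)]] with a and b real, and
diag(a(x) / (2 sin(x/2)), 1) symmetrizes it.  The first entry equals
sum_k t_k sin(kx/2)^2 / sin(x/2)^2, which gives the weights above.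

Conservation ([energy_flux_eq0], [energy_conserved]) holds because beta is odd
and alpha is antisymmetric about -1/2: the beta terms cancel against
themselves, and summing the alpha terms by parts produces exactly the
differences u_(j+k) - u_j that drive the sums of k consecutive averages.
Equivalence with the l2 norm ([energy_coercive], [energy_bounded]) requires in
addition that every t_k is positive.

These facts about the coefficients follow from the order of accuracy.
Evaluating the order condition on monomials as h tends to 0 yields
([hermite_stencil_exact]), for every polynomial P of degree at most 2m + 1,
  sum_k alpha_k (P(k+1) - P(k)) + sum_k beta_k P'(k) = P''(0).
After summation by parts this is a functional of Hermite interpolation type, in
the values of P at |k| <= r and of P' at |k| <= s, with as many data as the
space of polynomials has dimensions.  Polynomials that vanish at all nodes but
one isolate single coefficients.  Comparing such a test polynomial with its
reflection x -> -x proves the symmetries ([beta_odd], [alpha_odd]).  For positivity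
([jump_gt0]) let Q vanish at all nodes except k.  Testing with (X - k) Q and
with Q eliminates beta_k and gives, if k is also a node for derivatives,
  t_k = (Q''(0) / Q(k)) (1 + k Q'(k) / Q(k)),
and t_k = Q''(0) / Q(k) otherwise.  A sign count in the products shows that
Q''(0) Q(k) > 0, and the logarithmic derivative Q'(k) / Q(k) is a sum of
reciprocals of positive integers, because nodes at equal distance on both sides
of k cancel and the unpaired ones lie to the left of k. *)

(** * Test polynomials with prescribed zeros *)

Section HermiteTestPolynomials.
Variable R : realFieldType.
Implicit Types (P : {poly R}) (n k : nat).

Lemma derivM_horner P (Q : {poly R}) (x : R) :
  (P * Q)^`().[x] = P^`().[x] * Q.[x] + P.[x] * Q^`().[x].
Proof. by rewrite derivM hornerD !hornerM. Qed.

Lemma deriv_prod_XsubC_horner (I : eqType) (s : seq I) (c : I -> R) (x : R) :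
  (forall i, i \in s -> x != c i) ->
  (\prod_(i <- s) ('X - (c i)%:P))^`().[x]
  = (\prod_(i <- s) ('X - (c i)%:P)).[x] * \sum_(i <- s) (x - c i)^-1.
Proof.
elim: s => [|a s IHs] xs; first by rewrite !big_nil derivC hornerC mulr0.
rewrite !big_cons derivM derivXsubC mul1r hornerD !hornerM IHs; last first.
  by move=> i si; apply: xs; rewrite inE si orbT.
have xa : x - c a != 0 by rewrite subr_eq0 xs ?mem_head.
by rewrite hornerXsubC mulrDr mulrAC mulfV // mul1r mulrA.
Qed.

(** The nodes other than [k] in [-n, n] are listed by their distance to [k].
This makes the cancellation between the two sides of [k] visible, and thanks to
the truncated subtraction it also covers [k = n + 1], where [k] is no node. *)
Definition left_nodes n k : {poly R} :=
  \prod_(1 <= i < (n + k).+1) ('X - ((k%:Z - i%:Z)%:~R)%:P).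

Definition right_nodes n k : {poly R} :=
  \prod_(1 <= i < (n - k).+1) ('X - ((k%:Z + i%:Z)%:~R)%:P).

Definition punctured_nodes n k : {poly R} := left_nodes n k * right_nodes n k.

Lemma root_punctured_nodes n k (j : int) :
  (`|j| <= n)%N -> j != k%:Z -> root (punctured_nodes n k) j%:~R.
Proof.
move=> jn jk; rewrite /punctured_nodes rootM.
case: (ltrP j k%:Z) => jk'; apply/orP; [left|right].
- rewrite /root /left_nodes horner_prod (bigD1_seq `|k%:Z - j|%N) ?iota_uniq //=.
    rewrite hornerXsubC.
    have -> : k%:Z - `|k%:Z - j|%N%:Z = j by lia.
    by rewrite subrr mul0r.
  by rewrite mem_index_iota; lia.
- rewrite /root /right_nodes horner_prod (bigD1_seq `|j - k%:Z|%N) ?iota_uniq //=.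
    rewrite hornerXsubC.
    have -> : k%:Z + `|j - k%:Z|%N%:Z = j by lia.
    by rewrite subrr mul0r.
  by rewrite mem_index_iota; lia.
Qed.

Lemma size_punctured_nodes n k :
  size (punctured_nodes n k) = ((n + k) + (n - k)).+1.
Proof.
rewrite size_mul ?monic_neq0 ?monic_prod_XsubC //.
rewrite !size_prod_XsubC !size_iota; lia.
Qed.

Definition harmonic_gap n k : R :=
  \sum_((n - k).+1 <= i < (n + k).+1) i%:R^-1.

Lemma harmonic_gap_ge0 n k : 0 <= harmonic_gap n k.
Proof. by apply: sumr_ge0 => i _; rewrite invr_ge0 ler0n. Qed.

(** Evaluated at [k], the logarithmic derivative is the sum of [1 / i] over the
left nodes [k - i] minus the same sum over the right nodes [k + i]; only the
unpaired left nodes survive. *)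
Lemma deriv_punctured_nodes n k :
  (punctured_nodes n k)^`().[k%:R]
  = (punctured_nodes n k).[k%:R] * harmonic_gap n k.
Proof.
rewrite /punctured_nodes derivM hornerD !hornerM.
rewrite !deriv_prod_XsubC_horner; first last.
- move=> i; rewrite mem_index_iota => /andP[i0 _].
  by rewrite (pmulrn 1 k) eqr_int; lia.
- move=> i; rewrite mem_index_iota => /andP[i0 _].
  by rewrite (pmulrn 1 k) eqr_int; lia.
rewrite -/(left_nodes n k) -/(right_nodes n k).
rewrite (_ : harmonic_gap n k =
   \sum_(1 <= i < (n + k).+1) (k%:R - (k%:Z - i%:Z)%:~R)^-1
   + \sum_(1 <= i < (n - k).+1) (k%:R - (k%:Z + i%:Z)%:~R)^-1); first by ring.
rewrite (@big_cat_nat _ _ _ (n - k).+1 1 (n + k).+1) ?ltnS ?leq_addr //=; last first.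
  by rewrite (leq_trans (leq_subr _ _)) ?leq_addr.
rewrite addrAC -big_split /= big1 ?add0r.
  apply: eq_bigr => i _; congr (_^-1); rewrite intrB -!pmulrn; ring.
move=> i _; rewrite intrB intrD -!pmulrn.
have -> : k%:R - (k%:R - i%:R) = i%:R :> R by ring.
have -> : k%:R - (k%:R + i%:R) = - i%:R :> R by ring.
by rewrite invrN subrr.
Qed.

Lemma right_nodes_same_sign n k :
  0 < (right_nodes n k).[0] * (right_nodes n k).[k%:R].
Proof.
rewrite /right_nodes !horner_prod -big_split /=.
rewrite big_nat_cond; apply: prodr_gt0 => i /andP[/andP[i0 _] _].
rewrite !hornerXsubC intrD -!pmulrn.
have -> : (0 - (k%:R + i%:R)) * (k%:R - (k%:R + i%:R)) = (k%:R + i%:R) * i%:R :> R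
  by ring.
by rewrite mulr_gt0 ?addr_ge0 // -?natrD ltr0n; lia.
Qed.

Lemma left_nodes_gt0 n k : 0 < (left_nodes n k).[k%:R].
Proof.
rewrite /left_nodes horner_prod big_nat_cond.
apply: prodr_gt0 => i /andP[/andP[i0 _] _].
rewrite hornerXsubC intrB -!pmulrn.
have -> : k%:R - (k%:R - i%:R) = i%:R :> R by ring.
by rewrite ltr0n.
Qed.

(** The factor [i = k] is [X]; at 0 the factors with [i < k] are negative and
those with [i > k] are positive. *)
Lemma left_nodes_factor n k : (0 < k)%N ->
  exists2 A : {poly R}, left_nodes n k = 'X * A & 0 < (-1) ^+ k.-1 * A.[0].
Proof.
move=> k0; rewrite /left_nodes.
rewrite (@big_cat_nat _ _ _ k) //=; last by lia.
rewrite [X in _ * X]big_ltn; last by lia.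
rewrite subrr mulr0z subr0 mulrCA; eexists; first by [].
rewrite hornerM !horner_prod mulrA mulr_gt0 //; last first.
  rewrite big_nat_cond; apply: prodr_gt0 => i /andP[/andP[i0 _] _].
  rewrite hornerXsubC sub0r -intrN ltr0z; lia.
rewrite -subn1 -(prodr_const_nat 1 k (-1 : R)).
rewrite -big_split /= big_nat_cond.
apply: prodr_gt0 => i /andP[/andP[_ ik] _].
by rewrite hornerXsubC sub0r mulN1r opprK ltr0z subr_gt0 ltz_nat.
Qed.

(** The sign depends on [k] only and not on [n].  Hence it cancels in a product
over two radii, whichever of them contain [k]. *)
Lemma punctured_nodes_factor n k : (0 < k)%N ->
  exists2 B : {poly R}, punctured_nodes n k = 'X * B &
    0 < (-1) ^+ k.-1 * (B.[0] * (punctured_nodes n k).[k%:R]).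
Proof.
move=> k0; have [A EA Apos] := left_nodes_factor n k0.
exists (A * right_nodes n k); first by rewrite /punctured_nodes EA mulrA.
rewrite /punctured_nodes !hornerM.
have := mulr_gt0 Apos (mulr_gt0 (left_nodes_gt0 n k) (right_nodes_same_sign n k)).
by congr (0 < _); ring.
Qed.

Lemma deriv2_X2 P : ('X ^+ 2 * P)^`()^`().[0] = 2 * P.[0].
Proof.
rewrite !(derivM, derivX, derivD) !hornerE /=; ring.
Qed.

(** For [s <= r] this is the monic polynomial with double zeros at the [|j| <= s]
and simple zeros at the [s < |j| <= r], except for the zero at [k], which is
removed together with its multiplicity. *)
Definition hermite_test r s k : {poly R} :=
  punctured_nodes r k * punctured_nodes s k.

(** Both factors vanish at 0, so the second derivative there is twice the product
of their derivatives, and [punctured_nodes_factor] gives the signs. *)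
Lemma hermite_test_curvature r s k : (0 < k)%N ->
  0 < (hermite_test r s k)^`()^`().[0] * (hermite_test r s k).[k%:R].
Proof.
move=> k0; have [B EB Bpos] := punctured_nodes_factor r k0.
have [C EC Cpos] := punctured_nodes_factor s k0.
have -> : (hermite_test r s k)^`()^`().[0] = 2 * (B.[0] * C.[0]).
  by rewrite /hermite_test EB EC -hornerM -deriv2_X2; congr (_^`()^`().[0]); ring.
rewrite /hermite_test hornerM.
have two_gt0 : 0 < 2 :> R by rewrite ltr0n.
move: (mulr_gt0 two_gt0 (mulr_gt0 Bpos Cpos)); congr (0 < _).
set e := (-1) ^+ k.-1.
have e2 : e * e = 1 by rewrite -expr2 sqrr_sign.
transitivity ((e * e) * (2 * (B.[0] * (punctured_nodes r k).[k%:R])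
  * (C.[0] * (punctured_nodes s k).[k%:R]))); first by ring.
by rewrite e2 mul1r; ring.
Qed.

Lemma deriv_hermite_test r s k :
  (hermite_test r s k)^`().[k%:R]
  = (hermite_test r s k).[k%:R] * (harmonic_gap r k + harmonic_gap s k).
Proof.
rewrite /hermite_test hornerM derivM_horner !deriv_punctured_nodes; ring.
Qed.

Lemma deriv_hermite_test0 r s k : (0 < k)%N -> (hermite_test r s k)^`().[0] = 0.
Proof.
move=> k0; have [B EB _] := punctured_nodes_factor r k0.
have [C EC _] := punctured_nodes_factor s k0.
rewrite /hermite_test EB EC !derivM !derivX !hornerE /=; ring.
Qed.

Lemma hermite_test_neq0 r s k : (0 < k)%N -> (hermite_test r s k).[k%:R] != 0.
Proof.
move=> /(hermite_test_curvature r s); apply: contraTneq => ->.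
by rewrite mulr0 ltxx.
Qed.

Lemma root_hermite_test r s k (j : int) : (`|j| <= r)%N -> j != k%:Z ->
  (hermite_test r s k).[j%:~R] = 0.
Proof.
move=> jr jk; rewrite /hermite_test hornerM.
by rewrite (rootP (root_punctured_nodes jr jk)) mul0r.
Qed.

Lemma root_deriv_hermite_test r s k (j : int) :
  (`|j| <= r)%N -> (`|j| <= s)%N -> j != k%:Z ->
  (hermite_test r s k)^`().[j%:~R] = 0.
Proof.
move=> jr js jk; rewrite /hermite_test derivM_horner.
rewrite (rootP (root_punctured_nodes jr jk)) (rootP (root_punctured_nodes js jk)).
by rewrite mulr0 mul0r addr0.
Qed.

Lemma hermite_test_center_neq0 r s : (hermite_test r s 0).[0] != 0.
Proof.
have D0 n : (punctured_nodes n 0).[0] != 0.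
  rewrite /punctured_nodes hornerM mulf_neq0 //.
    by rewrite gt_eqF // (left_nodes_gt0 n 0).
  have := right_nodes_same_sign n 0.
  by apply: contraTneq => ->; rewrite mul0r ltxx.
by rewrite /hermite_test hornerM mulf_neq0.
Qed.

Lemma size_hermite_test r s k :
  (k <= r)%N -> (size (hermite_test r s k) <= (r + s).*2.+1 + (k - s))%N.
Proof.
move=> kr; rewrite (leq_trans (size_polyMleq _ _)) // !size_punctured_nodes; lia.
Qed.
End HermiteTestPolynomials.

(** * Symmetry and positivity of the coefficients *)

Section StencilCoefficients.
Variables (R : realFieldType) (r s : nat) (alpha beta : int -> R).
Implicit Types P : {poly R}.

Definition stencil (v w : int -> R) : R :=
  \sum_(i < r.*2) alpha (i%:Z - r%:Z) * v (i%:Z - r%:Z)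
  + \sum_(i < s.*2.+1) beta (i%:Z - s%:Z) * w (i%:Z - s%:Z).

(** The discrete operator with unit mesh width applied to the derivative of [P]:
the cell averages of [P'] are the increments of [P]. *)
Definition hermite_stencil P : R :=
  stencil (fun k => P.[(k + 1)%:~R] - P.[k%:~R]) (fun k => P^`().[k%:~R]).

(** Extending alpha by zero absorbs the boundary terms of the summation by parts,
so that [jump k] is the total weight of [P.[k]] for every [|k| <= r]. *)
Definition padded_alpha (k : int) : R :=
  if (- r%:Z <= k) && (k < r%:Z) then alpha k else 0.

Definition jump (k : int) : R := padded_alpha (k - 1) - padded_alpha k.

Definition padded_beta (k : int) : R := if (`|k| <= s)%N then beta k else 0.

Lemma sum_by_parts (p : int -> R) :
  \sum_(i < r.*2) alpha (i%:Z - r%:Z) * (p (i%:Z - r%:Z + 1) - p (i%:Z - r%:Z))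
  = \sum_(i < r.*2.+1) jump (i%:Z - r%:Z) * p (i%:Z - r%:Z).
Proof.
have padE (i : 'I_r.*2) : padded_alpha (i%:Z - r%:Z) = alpha (i%:Z - r%:Z).
  rewrite /padded_alpha ifT //; have := ltn_ord i; lia.
under [RHS]eq_bigr do rewrite mulrBl.
rewrite sumrB big_ord_recl big_ord_recr /=.
have -> : padded_alpha (0%:Z - r%:Z - 1) = 0.
  rewrite /padded_alpha ifF //; lia.
have -> : padded_alpha (r.*2%:Z - r%:Z) = 0.
  rewrite /padded_alpha ifF //; lia.
rewrite !mul0r add0r addr0 -sumrB; apply: eq_bigr => i _.
rewrite -padE mulrBr; congr (padded_alpha _ * p _ - _); rewrite /bump /=; lia.
Qed.

Lemma sum_centered_single n (c : int) (F : int -> R) :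
  (forall j : int, (`|j| <= n)%N -> j != c -> F j = 0) ->
  \sum_(i < n.*2.+1) F (i%:Z - n%:Z) = if (`|c| <= n)%N then F c else 0.
Proof.
move=> F0; case: ifPn => cn.
- have ltc : (`|(c + n%:Z)%R| < n.*2.+1)%N by lia.
  rewrite (bigD1 (Ordinal ltc)) //= big1 ?addr0.
    by congr F; lia.
  move=> i; rewrite -val_eqE /= => ic; apply: F0; have := ltn_ord i; lia.
- apply: big1 => i _; apply: F0; have := ltn_ord i; first by lia.
  by move=> ?; apply: contraNneq cn => <-; lia.
Qed.

Lemma hermite_stencil_single (c : int) P : (`|c| <= r)%N ->
  (forall j : int, (`|j| <= r)%N -> j != c -> P.[j%:~R] = 0) ->
  (forall j : int, (`|j| <= s)%N -> j != c -> P^`().[j%:~R] = 0) ->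
  hermite_stencil P = jump c * P.[c%:~R] + padded_beta c * P^`().[c%:~R].
Proof.
move=> cr P0 dP0; rewrite /hermite_stencil /stencil.
rewrite (sum_by_parts (fun k => P.[k%:~R])).
rewrite (@sum_centered_single r c (fun k => jump k * P.[k%:~R])); last first.
  by move=> j jr jc; rewrite P0 // mulr0.
rewrite cr.
rewrite (@sum_centered_single s c (fun k => beta k * P^`().[k%:~R])); last first.
  by move=> j js jc; rewrite dP0 // mulr0.
by rewrite /padded_beta; case: ifP => //; rewrite mul0r.
Qed.

Definition reflect_poly P := P \Po (- 'X).

Lemma horner_reflect P x : (reflect_poly P).[x] = P.[- x].
Proof. by rewrite horner_comp hornerN hornerX. Qed.

Lemma deriv_reflect P : (reflect_poly P)^`() = - reflect_poly P^`().
Proof. by rewrite deriv_comp derivN derivX mulrN1. Qed.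

Lemma size_reflect P : size (reflect_poly P) = size P.
Proof. by rewrite size_comp_poly2 // size_polyN size_polyX. Qed.

Lemma alpha_sum_jump k : (k < r)%N ->
  alpha k%:Z = \sum_(k.+1 <= i < r.+1) jump i%:Z.
Proof.
move=> kr; rewrite -[LHS]opprK.
have := telescope_sumr (fun i : nat => - padded_alpha (i%:Z - 1)) (n := k.+1) (m := r.+1).
rewrite ltnW // => /(_ isT); rewrite /padded_alpha.
rewrite ifF; last by lia.
rewrite ifT; last by lia.
rewrite oppr0 sub0r !opprK => E.
rewrite (_ : k%:Z = k.+1%:Z - 1); last by lia.
rewrite -E; apply: eq_bigr => i _.
rewrite /jump opprK addrC; congr (_ - padded_alpha _); lia.
Qed.

Hypothesis (sr : (s <= r)%N) (rs : (r <= s.+1)%N).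
(** The degree bound in [exact_stencil] is the one of Hermite interpolation:
there are [2r + 1] values and [2s + 1] derivatives. *)
Hypothesis exact_stencil : forall P, (size P <= (r + s).*2.+2)%N ->
  hermite_stencil P = P^`()^`().[0].

(** The right-hand side [P''(0)] is invariant under [x -> -x], so the coefficients
at [c] and at [- c] satisfy the same equation up to the sign of derivatives. *)
Lemma reflected_stencil_single (c : int) P : (`|c| <= r)%N ->
  (size P <= (r + s).*2.+2)%N ->
  (forall j : int, (`|j| <= r)%N -> j != c -> P.[j%:~R] = 0) ->
  (forall j : int, (`|j| <= s)%N -> j != c -> P^`().[j%:~R] = 0) ->
  jump c * P.[c%:~R] + padded_beta c * P^`().[c%:~R] = P^`()^`().[0] /\
  jump (- c) * P.[c%:~R] - padded_beta (- c) * P^`().[c%:~R] = P^`()^`().[0].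
Proof.
move=> cr szP P0 dP0; split.
  by rewrite -hermite_stencil_single // exact_stencil.
have := exact_stencil (P := reflect_poly P).
rewrite size_reflect => /(_ szP).
rewrite (@hermite_stencil_single (- c)) ?abszN //; first last.
- move=> j js jc; rewrite deriv_reflect hornerN horner_reflect -intrN.
  by rewrite dP0 ?abszN ?oppr0 // eqr_oppLR.
- by move=> j js jc; rewrite horner_reflect -intrN P0 ?abszN // eqr_oppLR.
rewrite deriv_reflect hornerN !horner_reflect -intrN opprK mulrN => ->.
by rewrite derivN deriv_reflect opprK horner_reflect oppr0.
Qed.

(** The extra factor [X - k] kills the value at [k] and leaves the derivative
[Q.[k]], which isolates beta. *)
Lemma beta_test k : (k <= s)%N ->
  let Q : {poly R} := hermite_test R r s k in
  let W := ('X - (k%:R)%:P) * Q in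
  beta k%:Z * Q.[k%:R] = W^`()^`().[0] /\
  - beta (- k%:Z) * Q.[k%:R] = W^`()^`().[0].
Proof.
move=> ks Q W; have kr := leq_trans ks sr.
have szW : (size W <= (r + s).*2.+2)%N.
  rewrite (leq_trans (size_polyMleq _ _)) // size_XsubC /=.
  have := size_hermite_test R s kr; rewrite -/Q; move: (size Q) => q; lia.
have dW x : W^`().[x] = Q.[x] + (x - k%:R) * Q^`().[x].
  by rewrite derivM_horner derivXsubC hornerC mul1r hornerXsubC.
have [||] := @reflected_stencil_single k%:Z W kr szW.
- by move=> j jr jk; rewrite hornerM root_hermite_test ?mulr0.
- move=> j js jk; rewrite dW root_deriv_hermite_test //; last exact: leq_trans sr.
  by rewrite root_hermite_test ?mulr0 ?addr0 // (leq_trans js).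
rewrite /padded_beta abszN absz_nat ks dW -pmulrn subrr mul0r addr0.
by rewrite hornerM hornerXsubC subrr mul0r !mulr0 !add0r mulNr => -> ->.
Qed.

Lemma beta_odd (k : int) : (`|k| <= s)%N -> beta (- k) = - beta k.
Proof.
have nat_odd i : (i <= s)%N -> beta (- i%:Z) = - beta i%:Z.
  move=> /beta_test [<- /mulIf] E; rewrite -E ?opprK //.
  by case: i {E} => [|i]; [exact: hermite_test_center_neq0|exact: hermite_test_neq0].
case: k => k ks; first exact: nat_odd.
by rewrite NegzE opprK nat_odd ?opprK //; lia.
Qed.

Lemma jump_test k : (0 < k)%N -> (k <= r)%N ->
  let Q : {poly R} := hermite_test R r s k in
  jump k%:Z * Q.[k%:R] + padded_beta k%:Z * Q^`().[k%:R] = Q^`()^`().[0] /\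
  jump (- k%:Z) * Q.[k%:R] - padded_beta (- k%:Z) * Q^`().[k%:R] = Q^`()^`().[0].
Proof.
move=> k0 kr Q; have := @reflected_stencil_single k%:Z Q kr.
rewrite -pmulrn; apply.
- have := size_hermite_test R s kr; rewrite -/Q; move: (size Q) => q; lia.
- by move=> j jr jk; rewrite root_hermite_test.
- by move=> j js jk; rewrite root_deriv_hermite_test // (leq_trans js).
Qed.

Lemma padded_beta_odd (k : int) : padded_beta (- k) = - padded_beta k.
Proof.
by rewrite /padded_beta abszN; case: ifP => [/beta_odd//|_]; rewrite oppr0.
Qed.

Lemma jump_even k : (0 < k)%N -> (k <= r)%N -> jump (- k%:Z) = jump k%:Z.
Proof.
move=> k0 kr; have [E1 E2] := jump_test k0 kr.
apply: (mulIf (hermite_test_neq0 R r s k0)); move: E2.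
by rewrite -E1 padded_beta_odd mulNr opprK => /addIr.
Qed.

Lemma deriv2_XsubC_mul (c x : R) P :
  (('X - c%:P) * P)^`()^`().[x] = 2 * P^`().[x] + (x - c) * P^`()^`().[x].
Proof.
rewrite derivM derivXsubC mul1r derivD hornerD derivM_horner derivXsubC.
rewrite hornerC hornerXsubC; ring.
Qed.

(** Multiplying the equation of [jump_test] by [q = Q.[k]] gives
[jump k * q^2 = y q - (beta_k q) q H], where [y] is the second derivative of [Q]
at 0 and [H] its logarithmic derivative at [k].  By [beta_test],
[beta_k q = - k y] if [k <= s], and beta_k is padded by zero otherwise.  Hence
both terms are nonnegative and the first is positive. *)
Lemma jump_gt0 k : (0 < k)%N -> (k <= r)%N -> 0 < jump k%:Z.
Proof.
move=> k0 kr; have [E1 _] := jump_test k0 kr; move: E1 => /=.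
rewrite deriv_hermite_test.
have Q0 := hermite_test_neq0 R r s k0.
have curv := hermite_test_curvature R r s k0.
have H0 : 0 <= harmonic_gap R r k + harmonic_gap R s k.
  by rewrite addr_ge0 ?harmonic_gap_ge0.
(* This is [k y q] for [k <= s], and zero otherwise. *)
have betaQ : 0 <= - (padded_beta k%:Z * (hermite_test R r s k).[k%:R]
                     * (hermite_test R r s k).[k%:R]).
  rewrite /padded_beta absz_nat; case: ifP => [ks|_]; last first.
    by rewrite !mul0r oppr0.
  have [-> _] := beta_test ks.
  rewrite deriv2_XsubC_mul deriv_hermite_test0 // mulr0 add0r sub0r !mulNr opprK.
  by rewrite -mulrA mulr_ge0 // ltW.
move: Q0 curv H0 betaQ.
set q := (hermite_test R r s k).[_]; set y := (_^`()^`()).[0].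
set b := padded_beta _; set H := _ + _ => Q0 curv H0 betaQ E1.
have q2 : 0 < q ^+ 2 by rewrite exprn_even_gt0.
rewrite -(pmulr_lgt0 _ q2).
have -> : jump k%:Z * q ^+ 2 = y * q + - (b * q * q) * H by rewrite -E1; ring.
by rewrite ltr_wpDr // mulr_ge0.
Qed.

(** Up to sign, both sides are sums of jumps, over [i < - k] and over [i > k], and
the jumps are even by [jump_even]. *)
Lemma alpha_odd k : (k < r)%N -> alpha (- 1 - k%:Z) = - alpha k%:Z.
Proof.
move=> kr; rewrite alpha_sum_jump //.
have := telescope_sumr (fun i : nat => padded_alpha (- i%:Z)) (n := k.+1) (m := r.+1).
rewrite ltnW // => /(_ isT).
rewrite [padded_alpha (- r.+1%:Z)]/padded_alpha ifF; last by lia.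
rewrite [padded_alpha (- k.+1%:Z)]/padded_alpha ifT; last by lia.
rewrite sub0r (_ : - k.+1%:Z = - 1 - k%:Z); last by lia.
move/eqP; rewrite eq_sym eqr_oppLR => /eqP ->; congr (- _).
rewrite big_nat_cond [RHS]big_nat_cond; apply: eq_bigr => i /andP[/andP[ki ir] _].
rewrite -jump_even; [|lia..].
by rewrite /jump; congr (padded_alpha _ - _); lia.
Qed.
End StencilCoefficients.

(** * The discrete energy *)

Local Open Scope classical_set_scope.

Section DiscreteEnergy.
Variables (R : realType) (N : nat).
Implicit Types (f v w : int -> R).

Definition grid_sum f : R := \sum_(j < N) f j%:Z.

Lemma eq_grid_sum f g : f =1 g -> grid_sum f = grid_sum g.
Proof. by move=> fg; apply: eq_bigr => j _; exact: fg. Qed.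

Lemma grid_sum_shift f (c : int) : periodic f N%:Z ->
  grid_sum (fun j => f (j + c)) = grid_sum f.
Proof.
have shift1 g : periodic g N%:Z -> grid_sum (fun j => g (j + 1)) = grid_sum g.
  rewrite /grid_sum; case: N => [|n] pg; first by rewrite !big_ord0.
  rewrite big_ord_recr big_ord_recl /= addrC.
  have -> : n%:Z + 1 = 0 + n.+1%:Z by lia.
  rewrite pg; congr (_ + _); apply: eq_bigr => i _; congr g.
  by rewrite /bump /=; lia.
have shiftn (n : nat) g : periodic g N%:Z ->
    grid_sum (fun j => g (j + n%:Z)) = grid_sum g.
  elim: n g => [|n IHn] g pg.
    by apply: eq_grid_sum => j; rewrite addr0.
  rewrite -(IHn _ pg) -(shift1 (fun j => g (j + n%:Z))); last first.
    by move=> j; rewrite addrAC pg.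
  by apply: eq_grid_sum => j; congr g; lia.
case: c => n pf; first exact: shiftn.
rewrite -(shiftn n.+1 (fun j => f (j + Negz n))); last first.
  by move=> j; rewrite addrAC pf.
by apply: eq_grid_sum => j; congr f; lia.
Qed.

Lemma grid_sumD f g :
  grid_sum (fun j => f j + g j) = grid_sum f + grid_sum g.
Proof. exact: big_split. Qed.

Lemma grid_sumB f g :
  grid_sum (fun j => f j - g j) = grid_sum f - grid_sum g.
Proof. exact: sumrB. Qed.

Lemma grid_sumZ a f : grid_sum (fun j => a * f j) = a * grid_sum f.
Proof. by rewrite /grid_sum mulr_sumr. Qed.

Lemma grid_sum_sum (I : Type) (l : seq I) (F : I -> int -> R) :
  grid_sum (fun j => \sum_(i <- l) F i j) = \sum_(i <- l) grid_sum (F i).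
Proof. exact: exchange_big. Qed.

Lemma grid_sum_sqr_ge0 f : 0 <= grid_sum (fun j => f j ^+ 2).
Proof. by apply: sumr_ge0 => j _; exact: sqr_ge0. Qed.

Definition cell_sum (k : nat) v (j : int) : R := \sum_(0 <= i < k) v (j + i%:Z).

(** The constant [4 ^ k] comes from [(a + b)^2 <= 2 a^2 + 2 b^2] at each step; what
matters is that it does not depend on [N]. *)
Lemma cell_sum_sqr_le k v : periodic v N%:Z ->
  grid_sum (fun j => cell_sum k v j ^+ 2) <= 4 ^+ k * grid_sum (fun j => v j ^+ 2).
Proof.
move=> pv; have V0 := grid_sum_sqr_ge0 v.
elim: k => [|k IHk].
  rewrite expr0 mul1r; apply: le_trans V0.
  rewrite le_eqVlt; apply/orP; left; apply/eqP.
  by apply: big1 => j _; rewrite /cell_sum big_geq // expr0n.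
have step : grid_sum (fun j => cell_sum k.+1 v j ^+ 2) <=
    2 * grid_sum (fun j => cell_sum k v j ^+ 2) + 2 * grid_sum (fun j => v j ^+ 2).
  rewrite -[X in _ <= _ + 2 * X](@grid_sum_shift _ k%:Z); last first.
    by move=> j; rewrite pv.
  rewrite -!grid_sumZ -grid_sumD; apply: ler_sum => j _.
  rewrite /cell_sum big_nat_recr //=.
  have := sqr_ge0 (\sum_(0 <= i < k) v (j%:Z + i%:Z) - v (j%:Z + k%:Z)).
  by nra.
have k1 : 1 <= 4 ^+ k :> R by rewrite exprn_ege1 // ler1n.
rewrite exprS; nra.
Qed.

Lemma sum_triangle r (t e : nat -> R) :
  \sum_(0 <= k < r) (\sum_(k.+1 <= i < r.+1) t i) * e k
  = \sum_(1 <= i < r.+1) t i * \sum_(0 <= k < i) e k.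
Proof.
elim: r => [|r IHr]; first by rewrite !big_geq.
rewrite [RHS]big_nat_recr //= -IHr [in RHS]big_nat_recr //=.
rewrite [LHS]big_nat_recr //= big_nat1 mulrDr addrA; congr (_ + _).
rewrite mulr_sumr -big_split /= big_nat_cond [RHS]big_nat_cond.
apply: eq_bigr => i /andP[/andP[_ ir] _].
by rewrite big_nat_recr /= ?mulrDl // ltnS ltnW.
Qed.

Variables (r s : nat) (alpha beta : int -> R) (t : nat -> R).
Hypothesis alphaE : forall k, (k < r)%N ->
  alpha k%:Z = \sum_(k.+1 <= i < r.+1) t i.
Hypothesis alphaN : forall k, (k < r)%N -> alpha (- 1 - k%:Z) = - alpha k%:Z.
Hypothesis betaN : forall k : int, (`|k| <= s)%N -> beta (- k) = - beta k.

(** The autocorrelation of a periodic grid function is even, and beta is odd. *)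
Lemma beta_part_skew v : periodic v N%:Z ->
  grid_sum (fun j => v j * \sum_(i < s.*2.+1)
      beta (i%:Z - s%:Z) * v (j + (i%:Z - s%:Z))) = 0.
Proof.
move=> pv; pose d k := grid_sum (fun j => v j * v (j + k)).
have d_even k : d (- k) = d k.
  rewrite /d -(@grid_sum_shift _ k); last by move=> j; rewrite addrAC !pv.
  by apply: eq_grid_sum => j; rewrite addrK mulrC.
transitivity (\sum_(i < s.*2.+1) beta (i%:Z - s%:Z) * d (i%:Z - s%:Z)).
  under eq_grid_sum do rewrite mulr_sumr.
  rewrite grid_sum_sum; apply: eq_bigr => i _; rewrite -grid_sumZ.
  by apply: eq_grid_sum => j; rewrite mulrCA.
set S := \sum_(i < _) _.
suff : S = - S by lra.
rewrite /S {1}(reindex_inj rev_ord_inj) /= -sumrN; apply: eq_bigr => i _.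
have ltis := ltn_ord i.
have -> : (s.*2.+1 - i.+1)%N%:Z - s%:Z = - (i%:Z - s%:Z) by lia.
by rewrite d_even betaN ?mulNr //; lia.
Qed.

(** Write each alpha as the sum of the jumps beyond it and exchange the sums: the
averages to the right of [j] collect into [cell_sum k w j] and those to the left
into [cell_sum k w (j - k)].  A shift by [k] moves the latter onto [v (j + k)]. *)
Lemma alpha_part_by_cells v w : periodic v N%:Z -> periodic w N%:Z ->
  grid_sum (fun j => v j * \sum_(i < r.*2)
      alpha (i%:Z - r%:Z) * w (j + (i%:Z - r%:Z)))
  = \sum_(1 <= k < r.+1) t k *
      grid_sum (fun j => (v j - v (j + k%:Z)) * cell_sum k w j).
Proof.
move=> pv pw; pose d k := grid_sum (fun j => v j * w (j + k)).
transitivity (\sum_(i < r.*2) alpha (i%:Z - r%:Z) * d (i%:Z - r%:Z)).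
  under eq_grid_sum do rewrite mulr_sumr.
  rewrite grid_sum_sum; apply: eq_bigr => i _; rewrite -grid_sumZ.
  by apply: eq_grid_sum => j; rewrite mulrCA.
transitivity (\sum_(0 <= k < r) (\sum_(k.+1 <= i < r.+1) t i)
    * (d k%:Z - d (- 1 - k%:Z))).
  rewrite -(big_mkord xpredT (fun i => alpha (i%:Z - r%:Z) * d (i%:Z - r%:Z))).
  rewrite (@big_cat_nat _ _ _ r) //=; last by lia.
  have -> : \sum_(r <= i < r.*2) alpha (i%:Z - r%:Z) * d (i%:Z - r%:Z)
      = \sum_(0 <= i < r) alpha ((i + r)%N%:Z - r%:Z) * d ((i + r)%N%:Z - r%:Z).
    by rewrite -[X in \sum_(X <= _ < _) _]add0n big_addn -addnn addKn.
  rewrite [X in X + _]big_nat_rev -big_split /= big_nat_cond [RHS]big_nat_cond.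
  apply: eq_bigr => i /andP[/andP[_ ir] _].
  have -> : (0 + r - i.+1)%N%:Z - r%:Z = - 1 - i%:Z by lia.
  have -> : (i + r)%N%:Z - r%:Z = i%:Z by lia.
  by rewrite alphaN // -alphaE //; ring.
rewrite sum_triangle; apply: eq_bigr => k _; congr (_ * _).
rewrite sumrB.
under [RHS]eq_grid_sum do rewrite mulrBl.
rewrite grid_sumB; congr (_ - _).
  rewrite -grid_sum_sum; apply: eq_grid_sum => j.
  by rewrite /cell_sum mulr_sumr.
rewrite -(@grid_sum_shift _ (- k%:Z)); last first.
  move=> j; rewrite addrAC pv; congr (_ * _).
  by apply: eq_bigr => i _; rewrite addrAC pw.
rewrite -grid_sum_sum; apply: eq_grid_sum => j.
rewrite subrK /cell_sum -mulr_sumr; congr (_ * _).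
rewrite big_nat_rev /= big_nat_cond [RHS]big_nat_cond.
apply: eq_bigr => i /andP[/andP[_ ik] _]; congr w; lia.
Qed.

Lemma cell_sum_diff k v j :
  cell_sum k (fun i => v (i + 1) - v i) j = v (j + k%:Z) - v j.
Proof.
rewrite /cell_sum -[X in _ - v X]addr0.
rewrite -(telescope_sumr (fun i : nat => v (j + i%:Z))) //.
by apply: eq_bigr => i _; congr (v _ - _); lia.
Qed.

(** Up to the factor [-2 / h], this is the time derivative of the energy when [w]
and [v] are the cell averages and the nodal values of a solution. *)
Lemma energy_flux_eq0 v w : periodic v N%:Z -> periodic w N%:Z ->
  grid_sum (fun j => v j * (\sum_(i < r.*2) alpha (i%:Z - r%:Z) * w (j + (i%:Z - r%:Z))
      + \sum_(i < s.*2.+1) beta (i%:Z - s%:Z) * v (j + (i%:Z - s%:Z))))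
  + \sum_(1 <= k < r.+1) t k * grid_sum (fun j =>
      cell_sum k w j * cell_sum k (fun i => v (i + 1) - v i) j) = 0.
Proof.
move=> pv pw.
under eq_grid_sum do rewrite mulrDr.
rewrite grid_sumD beta_part_skew // addr0 alpha_part_by_cells //.
rewrite -big_split big1 //= => k _; rewrite -mulrDr -grid_sumD.
rewrite [grid_sum _]big1 ?mulr0 // => j _.
rewrite cell_sum_diff; ring.
Qed.

Definition energy w v : R := grid_sum (fun j => v j ^+ 2)
  + \sum_(1 <= k < r.+1) t k * grid_sum (fun j => cell_sum k w j ^+ 2).

Hypothesis r_gt0 : (0 < r)%N.
Hypothesis t_gt0 : forall k, (0 < k)%N -> (k <= r)%N -> 0 < t k.

Lemma energy_coercive w v :
  grid_sum (fun j => w j ^+ 2) + grid_sum (fun j => v j ^+ 2)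
  <= (1 + (t 1)^-1) * energy w v.
Proof.
have t1 : 0 < t 1 by exact: t_gt0.
have w1 : t 1 * grid_sum (fun j => w j ^+ 2) + grid_sum (fun j => v j ^+ 2)
    <= energy w v.
  rewrite /energy addrC lerD2l big_ltn //.
  rewrite (_ : grid_sum (fun j => cell_sum 1 w j ^+ 2)
             = grid_sum (fun j => w j ^+ 2)); last first.
    by apply: eq_grid_sum => j; rewrite /cell_sum big_nat1 addr0.
  rewrite lerDl big_nat_cond; apply: sumr_ge0 => k /andP[/andP[k1 kr] _].
  by rewrite mulr_ge0 ?grid_sum_sqr_ge0 // ltW // t_gt0 //; lia.
have := grid_sum_sqr_ge0 w; have := grid_sum_sqr_ge0 v.
move: w1; set W := grid_sum (fun j => w j ^+ 2); set V := grid_sum _.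
move=> w1 V0 W0; rewrite mulrDl mul1r addrC; apply: lerD.
  by apply: le_trans w1; rewrite lerDr mulr_ge0 // ltW.
by rewrite ler_pdivlMl //; apply: le_trans w1; rewrite lerDl.
Qed.

Lemma energy_bounded w v : periodic w N%:Z ->
  energy w v <= (1 + \sum_(1 <= k < r.+1) t k * 4 ^+ k)
    * (grid_sum (fun j => w j ^+ 2) + grid_sum (fun j => v j ^+ 2)).
Proof.
move=> pw; rewrite /energy.
have W0 := grid_sum_sqr_ge0 w; have V0 := grid_sum_sqr_ge0 v.
have T0 : 0 <= \sum_(1 <= k < r.+1) t k * 4 ^+ k.
  rewrite big_nat_cond; apply: sumr_ge0 => k /andP[/andP[k1 kr] _].
  by rewrite mulr_ge0 ?exprn_ge0 // ltW // t_gt0 //; lia.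
have : \sum_(1 <= k < r.+1) t k * grid_sum (fun j => cell_sum k w j ^+ 2)
  <= (\sum_(1 <= k < r.+1) t k * 4 ^+ k) * grid_sum (fun j => w j ^+ 2).
  rewrite mulr_suml big_nat_cond [leRHS]big_nat_cond.
  apply: ler_sum => k /andP[/andP[k1 kr] _]; rewrite -mulrA ler_wpM2l //.
    by rewrite ltW // t_gt0 //; lia.
  exact: cell_sum_sqr_le.
set W := grid_sum (fun j => w j ^+ 2) in W0 *.
set V := grid_sum _ in V0 *.
by nra.
Qed.

End DiscreteEnergy.

(** * From the order of accuracy to exactness on polynomials *)

Section OrderConditions.
Variable R : realType.
Implicit Types P : {poly R}.

Lemma derive1n_horner P n : (horner P)^`(n)%classic = horner P^`(n).
Proof.
elim: n => [|n IHn]; first by rewrite derive1n0 derivn0.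
by rewrite derive1nS IHn derivnS derivE.
Qed.

Lemma continuously_differentiable_horner P n :
  continuously_differentiable n (horner P).
Proof.
split=> [k _ x|]; rewrite derive1n_horner; first exact: derivable_horner.
exact: continuous_horner.
Qed.

Lemma cell_average_deriv P (a h : R) : 0 < h ->
  cell_average (horner P^`()) a h = h^-1 * (P.[a + h] - P.[a]).
Proof.
move=> h0; rewrite /cell_average /Rintegral; congr (_ * _).
rewrite (@continuous_FTC2 R (horner P^`()) (horner P)) ?ltrDl //.
- exact/continuous_subspaceT/continuous_horner.
- split=> [x _||].
  + exact: derivable_horner.
  + exact/cvg_at_right_filter/continuous_horner.
  + exact/cvg_at_left_filter/continuous_horner.
- by move=> x _; rewrite -derivE.
Qed.

Variables (m : nat) (alpha beta : int -> R).
Let r := cell_radius m.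
Let s := node_radius m.

(** Homogeneity: on a monomial the dependence of the operator on [h] is a power,
so the asymptotic order condition becomes an algebraic identity. *)
Lemma hv_Dx_monomial q (h : R) : 0 < h ->
  let P : {poly R} := 'X^(q.+1) in
  h * hv_Dx m alpha beta h
        (fun k : int => cell_average (horner P^`()) (0 + k%:~R * h) h)
        (fun k : int => P^`().[0 + k%:~R * h]) 0
  = h ^+ q * hermite_stencil r s alpha beta P.
Proof.
move=> h0 P; have hn0 : h != 0 by rewrite gt_eqF.
rewrite /hv_Dx -mulrDr mulVKf // /hermite_stencil /stencil mulrDr !mulr_sumr.
congr (_ + _); apply: eq_bigr => i _ /=.
  rewrite cell_average_deriv // /P !hornerXn !add0r -/r [RHS]mulrCA; congr (_ * _).
  set k : int := i%:Z - r%:Z.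
  have -> : k%:~R * h + h = (k + 1)%:~R * h by rewrite intrD; ring.
  by rewrite !exprMn [h ^+ q.+1]exprS; field.
rewrite /P derivXn !hornerMn !hornerXn !add0r /= -/s exprMn [RHS]mulrCA; congr (_ * _).
by rewrite mulrnAr mulrC.
Qed.

(** The defect in the order condition is [h^(q-1)] times a constant, while the
condition bounds it by a multiple of [h^(2m+1)]; since [q <= 2m], the constant
vanishes.  The term of order [2m] in the expansion does not contribute, as the
derivative of order [2m + 1] of the test function is zero. *)
Lemma hermite_stencil_monomial q : has_order m alpha beta (m + m) ->
  (q <= m + m)%N ->
  hermite_stencil r s alpha beta 'X^(q.+1) = ('X^(q.+1))^`()^`().[0].
Proof.
move=> [c [_ ord]] qm; set P : {poly R} := 'X^(q.+1).
have := ord _ (continuously_differentiable_horner P^`() _) 0.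
move/eqO_exP => [K K0 bound].
apply/eqP; rewrite -subr_eq0 -normr_le0 leNgt; apply/negP.
set d := `|_| => d0.
near (0:R)^'+ => h.
have h0 : 0 < h by [].
have h1 : h < 1 by near: h; exact: nbhs_right_lt.
have hd : h < d / K by near: h; apply: nbhs_right_lt; rewrite divr_gt0.
have : `|hv_Dx m alpha beta h
         (fun k : int => cell_average (horner P^`()) (0 + k%:~R * h) h)
         (fun k : int => P^`().[0 + k%:~R * h]) 0
       - ((horner P^`())^`()%classic 0 + c * (horner P^`())^`((m + m).+1)%classic 0 * h ^+ (m + m))|
    <= K * `|h ^+ (m + m).+1|.
  by near: h; exact: bound.
rewrite -derivE derive1n_horner.
have -> : (P^`()^`((m + m).+1))%R = 0.
  by rewrite -derivSn derivn_poly0 // size_polyXn !ltnS.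
rewrite horner0 mulr0 mul0r addr0 -(ler_pM2l h0).
rewrite -[X in X * `|_|]gtr0_norm // -normrM mulrBr hv_Dx_monomial //.
have -> : h * P^`()^`().[0] = h ^+ q * P^`()^`().[0].
  rewrite /P derivXn derivMn derivXn; case: (q) => [|[|n]]; rewrite ?expr1 //.
    by rewrite mulr0n mul0rn horner0 !mulr0.
  by rewrite !hornerMn hornerXn expr0n /= !mul0rn !mulr0.
rewrite -mulrBr normrM -/d normrX gtr0_norm // normrX gtr0_norm // => le1.
(* As [h < 1] and [q <= 2m], the bound [K h^(2m+2)] is below [h^q (K h)], which
   contradicts [h < d / K]. *)
have : h ^+ q * d <= h ^+ q * (K * h).
  apply: (le_trans le1).
  rewrite mulrCA [leRHS]mulrCA ler_wpM2l ?(ltW K0) //.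
  rewrite -exprS -exprSr; apply: ler_wiXn2l; rewrite ?ltW //; lia.
rewrite ler_pM2l ?exprn_gt0 // leNgt mulrC -ltr_pdivlMr //.
by rewrite hd.
Unshelve. all: by end_near.
Qed.

Lemma hermite_stencilD P Q : hermite_stencil r s alpha beta (P + Q)
  = hermite_stencil r s alpha beta P + hermite_stencil r s alpha beta Q.
Proof.
rewrite /hermite_stencil /stencil addrACA -!big_split /=.
by congr (_ + _); apply: eq_bigr => i _; rewrite ?derivD !hornerD; ring.
Qed.

Lemma hermite_stencilZ (a : R) P : hermite_stencil r s alpha beta (a *: P)
  = a * hermite_stencil r s alpha beta P.
Proof.
rewrite /hermite_stencil /stencil mulrDr !mulr_sumr.
by congr (_ + _); apply: eq_bigr => i _; rewrite ?derivZ !hornerZ; ring.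
Qed.

Lemma hermite_stencil_exact P : has_order m alpha beta (m + m) ->
  (size P <= (m + m).+2)%N ->
  hermite_stencil r s alpha beta P = P^`()^`().[0].
Proof.
move=> ord szP; pose G Q := hermite_stencil r s alpha beta Q - Q^`()^`().[0].
suff : G P = 0 by move/eqP; rewrite subr_eq0 => /eqP.
have GD : {morph G : Q1 Q2 / Q1 + Q2}.
  by move=> Q1 Q2; rewrite /G hermite_stencilD !derivD hornerD; ring.
have GZ a Q : G (a *: Q) = a * G Q.
  by rewrite /G hermite_stencilZ !derivZ hornerZ; ring.
rewrite -[P]coefK poly_def (big_morph G GD (id1 := 0)); last first.
  by rewrite -(scale0r 0) GZ mul0r.
apply: big1 => i _; rewrite GZ /G.
case: (val i) (leq_trans (ltn_ord i) szP) => [|q] qm; last first.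
  by rewrite hermite_stencil_monomial // subrr mulr0.
rewrite /hermite_stencil /stencil expr0 !derivC hornerC.
rewrite !big1 ?addr0 ?subrr ?mulr0 // => k _; by rewrite !hornerC ?subrr mulr0.
Qed.

End OrderConditions.

(** * Conservation of the energy *)

Section EnergyConservation.
Variable R : realType.

Lemma is_derive_bigsum (I : Type) (l : seq I) (f : I -> R -> R) (df : I -> R) (x : R) :
  (forall i, is_derive x 1 (f i) (df i)) ->
  is_derive x 1 (fun t => \sum_(i <- l) f i t) (\sum_(i <- l) df i).
Proof.
move=> dfi; elim: l => [|i l IHl].
  rewrite big_nil; under eq_fun do rewrite big_nil; exact: is_derive_cst.
rewrite big_cons; under eq_fun do rewrite big_cons.
exact: is_deriveD.
Qed.

Lemma within_continuous_sum (A : set R) (I : Type) (l : seq I) (f : I -> R -> R) :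
  (forall i, {within A, continuous (f i)}) ->
  {within A, continuous (fun t => \sum_(i <- l) f i t)}.
Proof.
move=> cf; elim: l => [|i l IHl].
  under eq_fun do rewrite big_nil; exact: cst_continuous.
under eq_fun do rewrite big_cons.
by move=> x; apply: cvgD; [exact: cf|exact: IHl].
Qed.

Lemma within_continuous_sqr (A : set R) (f : R -> R) :
  {within A, continuous f} -> {within A, continuous (fun t => f t ^+ 2)}.
Proof. by move=> cf x; apply: cvgM; exact: cf. Qed.

Lemma within_continuousZ (A : set R) (a : R) (f : R -> R) :
  {within A, continuous f} -> {within A, continuous (fun t => a * f t)}.
Proof. by move=> cf x; apply: cvgM; [exact: cvg_cst|exact: cf]. Qed.

Lemma is_derive_sqr (f : R -> R) (x df : R) :
  is_derive x 1 f df -> is_derive x 1 (fun t => f t ^+ 2) (2 * (f x * df)).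
Proof.
move=> dfx; have dff := is_deriveM dfx dfx; apply: (is_derive_eq dff).
by rewrite /GRing.scale /=; ring.
Qed.

Lemma is_derive_scale (f : R -> R) (x a df : R) :
  is_derive x 1 f df -> is_derive x 1 (fun t => a * f t) (a * df).
Proof. by move=> dfx; exact: is_deriveZ. Qed.

Variables (N m : nat) (alpha beta : int -> R) (t : nat -> R).
Let r := cell_radius m.
Let s := node_radius m.
Hypothesis alphaE : forall k, (k < r)%N ->
  alpha k%:Z = \sum_(k.+1 <= i < r.+1) t i.
Hypothesis alphaN : forall k, (k < r)%N -> alpha (- 1 - k%:Z) = - alpha k%:Z.
Hypothesis betaN : forall k : int, (`|k| <= s)%N -> beta (- k) = - beta k.
Variables ubar u : int -> R -> R.
Hypothesis sol : hv_solution m alpha beta N ubar u.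

Let E (x : R) := energy N r t (ubar^~ x) (u^~ x).

(** The equations hold for positive times only, so continuity up to the initial
time is what links the energy to the initial data. *)
Lemma energy_continuous : {within `[0, +oo[, continuous E}.
Proof.
have [_ cont _ _] := sol; have cu j := (cont j).2; have cubar j := (cont j).1.
move=> x; apply: cvgD.
  by apply: within_continuous_sum => j; exact/within_continuous_sqr/cu.
apply: within_continuous_sum => k; apply: within_continuousZ.
apply: within_continuous_sum => j; apply: within_continuous_sqr.
by apply: within_continuous_sum => i; exact: cubar.
Qed.

Lemma energy_derive (x : R) : 0 < x -> is_derive x 1 E 0.
Proof.
move=> x0; have [per _ dubar du] := sol.
have [pw pv] := per x (ltW x0); pose h : R := N%:R^-1.
pose D j := \sum_(i < r.*2) alpha (i%:Z - r%:Z) * ubar (j + (i%:Z - r%:Z)) x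
      + \sum_(i < s.*2.+1) beta (i%:Z - s%:Z) * u (j + (i%:Z - s%:Z)) x.
have duj j : is_derive x 1 (u j) (- h^-1 * D j).
  have [dj eqj] := du j x x0; apply: DeriveDef => //.
  move: eqj; rewrite derive1E => /eqP; rewrite addr_eq0 => /eqP ->.
  by rewrite /hv_Dx -mulrDr mulNr.
pose F j := u (j + 1) x - u j x.
have dubarj j : is_derive x 1 (ubar j) (- h^-1 * F j).
  have [dj eqj] := dubar j x x0; apply: DeriveDef => //.
  move: eqj; rewrite derive1E => /eqP; rewrite addr_eq0 => /eqP ->.
  by rewrite mulNr.
have dS k j : is_derive x 1 (fun y => cell_sum k (ubar^~ y) j)
    (- h^-1 * cell_sum k F j).
  by rewrite /cell_sum mulr_sumr; apply: is_derive_bigsum => i; exact: dubarj.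
have dE : is_derive x 1 E
  (grid_sum N (fun j => 2 * (u j x * (- h^-1 * D j)))
   + \sum_(1 <= k < r.+1) t k * grid_sum N (fun j =>
       2 * (cell_sum k (ubar^~ x) j * (- h^-1 * cell_sum k F j)))).
  apply: is_deriveD.
    apply: (@is_derive_bigsum 'I_N _ (fun j y => u j%:Z y ^+ 2)) => j.
    exact: is_derive_sqr (duj j%:Z).
  apply: is_derive_bigsum => k; apply: is_derive_scale.
  apply: (@is_derive_bigsum 'I_N _
    (fun j y => cell_sum k (ubar^~ y) j%:Z ^+ 2)) => j.
  exact: is_derive_sqr (dS k j%:Z).
apply: is_derive_eq dE _.
have := energy_flux_eq0 alphaE alphaN betaN pv pw.
move/(congr1 ( *%R (- 2 * h^-1))); rewrite mulr0 => flux; rewrite -[RHS]flux.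
rewrite mulrDr -grid_sumZ mulr_sumr; congr (_ + _).
  by apply: eq_grid_sum => j; rewrite -/(D j); ring.
apply: eq_bigr => k _; rewrite [RHS]mulrCA; congr (_ * _); rewrite -grid_sumZ.
by apply: eq_grid_sum => j; ring.
Qed.

Lemma energy_conserved (x : R) : 0 <= x -> E x = E 0.
Proof.
move=> x0; apply/eqP; rewrite -subr_eq0; apply/eqP.
have E'0 y : y \in `]0, x[%R -> is_derive y 1 E 0.
  by rewrite in_itv /= => /andP[y0 _]; exact: energy_derive.
have cE : {within `[0, x], continuous E}.
  by apply: continuous_subspaceW energy_continuous; exact: subset_itvl.
have [y _ ->] := MVT_segment (df := fun=> 0) x0 E'0 cE.
by rewrite mul0r.
Qed.

End EnergyConservation.

Theorem theorem5p2 (R : realType) (m : nat) (alpha beta : int -> R) :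
  (1 <= m)%N ->
  has_order m alpha beta (m + m) ->
  exists C : R,
    forall (N : nat) (ubar u : int -> R -> R),
      (1 <= N)%N ->
      hv_solution m alpha beta N ubar u ->
      forall t : R, 0 <= t ->
        \sum_(j < N) (ubar j%:Z t) ^+ 2 + \sum_(j < N) (u j%:Z t) ^+ 2
        <= C * (\sum_(j < N) (ubar j%:Z 0) ^+ 2 + \sum_(j < N) (u j%:Z 0) ^+ 2).
Proof.
move=> m0 ord; pose r := cell_radius m; pose s := node_radius m.
have [sr rs rsm] : [/\ (s <= r)%N, (r <= s.+1)%N & (r + s)%N = m].
  by rewrite /r /s /cell_radius /node_radius; split; lia.
have exact_st (P : {poly R}) : (size P <= (r + s).*2.+2)%N ->
    hermite_stencil r s alpha beta P = P^`()^`().[0].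
  by rewrite rsm -addnn; exact: hermite_stencil_exact.
pose w k := jump r alpha k%:Z.
have w_gt0 k : (0 < k)%N -> (k <= r)%N -> 0 < w k.
  exact: (jump_gt0 sr rs exact_st).
have r0 : (0 < r)%N by lia.
exists ((1 + (w 1)^-1) * (1 + \sum_(1 <= k < r.+1) w k * 4 ^+ k)).
move=> N ubar u _ sol t t0.
have [per _ _ _] := sol; have [pw0 _] := per 0 (lexx 0).
have alphaE k : (k < r)%N -> alpha k%:Z = \sum_(k.+1 <= i < r.+1) w i.
  exact: alpha_sum_jump.
have alphaN k : (k < r)%N -> alpha (- 1 - k%:Z) = - alpha k%:Z.
  exact: (alpha_odd sr rs exact_st).
have betaN k : (`|k| <= s)%N -> beta (- k) = - beta k.
  exact: (beta_odd sr rs exact_st).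
apply: (le_trans (energy_coercive N r0 w_gt0 (ubar^~ t) (u^~ t))).
rewrite (energy_conserved alphaE alphaN betaN sol t0) -mulrA ler_wpM2l //.
  by rewrite addr_ge0 // invr_ge0 ltW // w_gt0.
exact: energy_bounded.
Qed.
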